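(* Let $G$ be a finite simple graph with $n$ vertices, $m$ edges and vertex degrees $d_1,\ldots,d_n$, without isolated vertices. Then $$s_Q(G)\ \le\ \sqrt{2\left(\sum_{i=1}^n d_i^2+2m\right)-\frac{8m^2}{n}}\ =\ \sqrt{2M_1(G)+4m-\frac{8m^2}{n}}.$$ Equality is attained if and only if $G\simeq K_{\frac n2,\frac n2}$.
   Context: For a finite simple graph $G$ on $n$ vertices, let $A_G$ be its adjacency matrix and $D_G$ the diagonal matrix of vertex degrees. The signless Laplacian matrix is $Q_G=D_G+A_G$ with eigenvalues $q_1\ge q_2\ge\cdots\ge q_n$, and the signless Laplacian spread is $s_Q(G)=q_1-q_n$. The first Zagreb index is $M_1(G)=\sum_{i=1}^n d_i^2$. $K_{p,q}$ is the complete bipartite graph with parts of sizes $p$ and $q$; the condition $G\simeq K_{\frac n2,\frac n2}$ includes that $n$ is even. *)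

(* Defs.v *)
From mathcomp Require Import all_boot all_order all_algebra.
From mathcomp Require Import polyrcf.

Set Implicit Arguments.
Unset Strict Implicit.
Unset Printing Implicit Defensive.

Import Order.TTheory GRing.Theory Num.Theory.
Local Open Scope ring_scope.

Record sgraph (T : finType) := SGraph {
  adj :> rel T;
  adj_sym : symmetric adj;
  adj_irr : irreflexive adj }.

Definition deg (T : finType) (G : sgraph T) (x : T) : nat := #|[set y | G x y]|.

Definition edges (T : finType) (G : sgraph T) : {set {set T}} :=
  [set [set p.1; p.2] | p : T * T & G p.1 p.2].

Definition no_isolated_vertex (T : finType) (G : sgraph T) : Prop :=
  forall x, exists y, G x y.

Definition zagreb1 (T : finType) (G : sgraph T) : nat :=
  (\sum_(x : T) deg G x ^ 2)%N.

Definition isomorphic (T1 T2 : finType) (G1 : sgraph T1) (G2 : sgraph T2) : Prop :=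
  exists2 f : T1 -> T2, bijective f & forall x y, G2 (f x) (f y) = G1 x y.

Definition Kbip_rel (p q : nat) : rel ('I_p + 'I_q)%type :=
  fun u v => match u, v with
             | inl _, inr _ | inr _, inl _ => true
             | _, _ => false
             end.

Lemma Kbip_sym p q : symmetric (@Kbip_rel p q).
Proof. by case=> ? []. Qed.

Lemma Kbip_irr p q : irreflexive (@Kbip_rel p q).
Proof. by case. Qed.

Definition Kbip (p q : nat) : sgraph ('I_p + 'I_q)%type :=
  SGraph (@Kbip_sym p q) (@Kbip_irr p q).

(* Vertices are numbered by [enum_val]. *)
Definition adjmx (R : pzSemiRingType) (T : finType) (G : sgraph T) : 'M[R]_#|T| :=
  \matrix_(i, j) (G (enum_val i) (enum_val j))%:R.

Definition degmx (R : pzSemiRingType) (T : finType) (G : sgraph T) : 'M[R]_#|T| :=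
  diag_mx (\row_i (deg G (enum_val i))%:R).

Definition signless_laplacian (R : pzSemiRingType) (T : finType) (G : sgraph T) :
  'M[R]_#|T| := degmx R G + adjmx R G.

(* The eigenvalues lying in [R], repeated according to their multiplicity as
   roots of the characteristic polynomial, in nonincreasing order ([rootsR]
   lists the distinct roots increasingly). For a symmetric [n x n] matrix over
   a real closed field there are exactly [n] of them. *)
Definition eigenvalues (R : rcfType) (n : nat) (M : 'M[R]_n) : seq R :=
  flatten [seq nseq (mup x (char_poly M)) x | x <- rev (rootsR (char_poly M))].

(* [q_i] is the entry of index [i - 1]. *)
Definition sQ (R : rcfType) (T : finType) (G : sgraph T) : R :=
  let q := eigenvalues (signless_laplacian R G) in q`_0 - q`_(#|T|.-1).

(* Main.v *)
Require Import Defs.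
From mathcomp Require Import all_boot all_order all_algebra.
From mathcomp Require Import polyrcf complex ring lra.
Import Order.TTheory GRing.Theory Num.Theory.
Local Open Scope ring_scope.

Set Implicit Arguments.
Unset Strict Implicit.
Unset Printing Implicit Defensive.

(* Put [c = 2m/n], the mean of the eigenvalues of [Q]. The traces of [Q] and
   [Q^2] give [2 sum (q_i - c)^2 = 2 (M_1 + 2m) - 8m^2/n], and the left side is
   at least [(q_1 - q_n)^2], with equality iff all [q_i] other than [q_1], [q_n]
   equal [c] and [q_1 + q_n = 2c].

   If equality holds, [N = Q - c] satisfies [N^3 = l^2 N] where
   [l = (q_1 - q_n) / 2], and [l <= c] because [q_n >= 0]. For the all-ones
   vector [w], [w N = 2d - c] has entries summing to [n c] and
   [|w N|^2 <= l^2 |w|^2 <= c^2 n]; this forces [d = c] and [l = c]. So [G] is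
   [c]-regular and [N] is its adjacency matrix [A]; comparing with the bound
   gives [n = 2c], and the diagonal of [A^3 = c^2 A] vanishes, so [G] is
   triangle-free. A [c]-regular triangle-free graph on [2c] vertices is
   [K_{c,c}]. Conversely [n] and [0] are eigenvalues of [Q] for [K_{n/2,n/2}]. *)

(** * Spectra of real symmetric matrices *)

Local Notation toC R := (real_complex R).

(** A real symmetric matrix is hermitian over [complex R], so the complex spectral theorem applies
    and its diagonal is real. [P] may stay complex: characteristic polynomials, traces and
    polynomial identities all descend along the injection [toC R]. *)
Lemma symmx_diagonalization (R : rcfType) n (M : 'M[R]_n) : M^T = M ->
  exists r : 'rV[R]_n, exists2 P : 'M[complex R]_n, P \in unitmx &
    map_mx (toC R) M = invmx P *m map_mx (toC R) (diag_mx r) *m P.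
Proof.
move=> symM; set N := map_mx _ M.
have realN : N \is a mxOver Num.real.
  by apply/mxOverP => i j; rewrite mxE; apply/complex_realP; exists (M i j).
have hermN : N \is hermsymmx.
  apply: realsym_hermsym => //; apply/is_hermitianmxP.
  by rewrite expr0 scale1r map_mx_id // /N map_trmx symM.
have /orthomx_spectralP defN := hermitian_normalmx hermN.
exists (map_mx (@complex.Re R) (spectral_diag N)), (spectralmx N).
  exact: spectral_unit.
suff -> : map_mx (toC R) (diag_mx (map_mx (@complex.Re R) (spectral_diag N)))
          = diag_mx (spectral_diag N) by [].
rewrite map_diag_mx; congr diag_mx; apply/matrixP => i j; rewrite !mxE.
by apply: RRe_real; apply: mxOverP (hermitian_spectral_diag_real hermN) i j.
Qed.

(** [rootsR] lists each root once, so at most the block of [x] contributes, and a non-root has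
    multiplicity 0. *)
Lemma count_mem_eigenvalues (R : rcfType) n (M : 'M[R]_n) x :
  count_mem x (eigenvalues M) = mup x (char_poly M).
Proof.
have p0 : char_poly M != 0 by rewrite -size_poly_eq0 size_char_poly.
rewrite /eigenvalues count_flatten -map_comp.
rewrite (eq_map (g := fun y => (y == x) * mup x (char_poly M))%N); last first.
  by move=> y /=; rewrite count_nseq /=; case: eqP => [->|].
rewrite sumnE big_map -big_distrl big_rev /=.
rewrite -big_mkcond /= sum1_count count_uniq_mem; last first.
  exact: (sorted_uniq lt_trans ltxx (sorted_roots _ _ _)).
have := roots_on_rootsR p0 x; rewrite in_itv /= => <-.
by case: (boolP (root _ x)) => [_|/mupNroot ->]; rewrite ?mul1n.
Qed.

Lemma mup_prod_XsubC (F : fieldType) (s : seq F) x :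
  mup x (\prod_(y <- s) ('X - y%:P)) = count_mem x s.
Proof.
elim: s => [|y s IHs]; first by rewrite big_nil mupNroot ?root1.
rewrite big_cons mupM ?polyXsubC_eq0 ?IHs //=; last first.
  by rewrite prodf_seq_neq0; apply/allP => z _; rewrite polyXsubC_eq0.
by rewrite -['X - y%:P]expr1 mup_XsubCX; case: (eqVneq x y).
Qed.

Lemma char_poly_conj (F : fieldType) n (A P : 'M[F]_n) : P \in unitmx ->
  char_poly (invmx P *m A *m P) = char_poly A.
Proof.
move=> uP; rewrite /char_poly /char_poly_mx !map_mxM.
have XC : 'X%:M = map_mx polyC (invmx P) *m 'X%:M *m map_mx polyC P.
  by rewrite scalar_mxC -mulmxA -map_mxM mulVmx // map_mx1 mulmx1.
rewrite [in LHS]XC -mulmxBl -mulmxBr.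
rewrite !det_mulmx mulrC mulrA -det_mulmx -map_mxM mulmxV //.
by rewrite map_mx1 det1 mul1r.
Qed.

(** Both multisets count [x] with its multiplicity in the characteristic polynomial, which
    conjugation by [P] preserves and which splits over the diagonal [r]. *)
Lemma perm_eigenvalues (R : rcfType) n (M : 'M[R]_n) (r : 'rV[R]_n)
    (P : 'M[complex R]_n) : P \in unitmx ->
  map_mx (toC R) M = invmx P *m map_mx (toC R) (diag_mx r) *m P ->
  perm_eq (eigenvalues M) [seq r 0 i | i <- enum 'I_n].
Proof.
move=> uP defM; apply/allP => x _ /=; rewrite count_mem_eigenvalues.
suff -> : char_poly M = \prod_(y <- [seq r 0 i | i <- enum 'I_n]) ('X - y%:P).
  by rewrite mup_prod_XsubC.
apply: (map_poly_inj (toC R)); rewrite map_char_poly defM char_poly_conj //.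
rewrite -map_char_poly char_poly_trig ?diag_mx_is_trig //.
rewrite big_map big_enum; congr map_poly.
by apply: eq_bigr => i _; rewrite mxE eqxx.
Qed.

(** Everything is read off the diagonal form. The last clause turns a cubic relation on the
    eigenvalues into one on the matrix; this is how equality in the bound becomes usable. *)
Lemma symmx_spectrum (R : rcfType) n (M : 'M[R]_n) : M^T = M ->
  [/\ size (eigenvalues M) = n,
      \sum_(x <- eigenvalues M) x = \tr M,
      \sum_(x <- eigenvalues M) x ^+ 2 = \tr (M *m M)
    & forall a b, {in eigenvalues M, forall x, (x - a) ^+ 3 = b * (x - a)} ->
        let N := M - a%:M in N *m N *m N = b *: N].
Proof.
move=> symM; have [r [P uP defM]] := symmx_diagonalization symM.
have pe := perm_eigenvalues uP defM.
have conjM (A B : 'M[complex R]_n) :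
    (invmx P *m A *m P) *m (invmx P *m B *m P) = invmx P *m (A *m B) *m P.
  by rewrite !mulmxA mulmxK.
have trM (A : 'M[complex R]_n) : \tr (invmx P *m A *m P) = \tr A.
  by rewrite mxtrace_mulC mulmxA mulmxV // mul1mx.
split.
- by rewrite (perm_size pe) size_map size_enum_ord.
- apply: (fmorph_inj (toC R)).
  rewrite -trace_map_mx defM trM trace_map_mx mxtrace_diag.
  by rewrite (perm_big _ pe) big_map big_enum.
- apply: (fmorph_inj (toC R)).
  rewrite -trace_map_mx map_mxM defM conjM trM -map_mxM trace_map_mx.
  rewrite mulmx_diag mxtrace_diag (perm_big _ pe) big_map big_enum.
  by congr (toC R _); apply: eq_bigr => i _; rewrite mxE expr2.
move=> a b hab N; apply: (map_mx_inj (f := toC R)); rewrite map_mxZ !map_mxM.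
have -> : map_mx (toC R) N
    = invmx P *m map_mx (toC R) (diag_mx (\row_i (r 0 i - a))) *m P.
  have -> : diag_mx (\row_i (r 0 i - a)) = diag_mx r - a%:M.
    by apply/matrixP => i j; rewrite !mxE mulrnBl.
  rewrite !map_mxB defM mulmxBr mulmxBl; congr (_ - _).
  by rewrite map_scalar_mx scalar_mxC -mulmxA mulVmx // mulmx1.
rewrite !conjM -!map_mxM !mulmx_diag scalemxAl scalemxAr -map_mxZ.
congr (_ *m map_mx _ _ *m _); apply/matrixP => i j; rewrite !mxE.
rewrite mulrnAr -hab; last by rewrite (perm_mem pe) map_f ?mem_enum.
by rewrite -mulrA.
Qed.

(** Constant blocks are laid along a strictly decreasing list of roots. This makes the first and
    last entries the extremal eigenvalues. *)
Lemma eigenvalues_sorted (R : rcfType) n (M : 'M[R]_n) :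
  sorted >=%R (eigenvalues M).
Proof.
rewrite /eigenvalues; set p := char_poly M.
have : sorted >%R (rev (rootsR p)) by rewrite rev_sorted; apply: sorted_roots.
elim: (rev _) => //= x s IHs; rewrite path_sortedE; last exact: rev_trans lt_trans.
case/andP => /allP lt_x /IHs; rewrite !sorted_pairwise; try exact: ge_trans.
move=> sorted_s; rewrite pairwise_cat sorted_s andbT; apply/andP; split.
  apply/allrelP => y z; rewrite mem_nseq => /andP[_ /eqP ->].
  case/flattenP => _ /mapP[t /lt_x /= ltx ->].
  by rewrite mem_nseq => /andP[_ /eqP ->]; apply: ltW.
elim: (mup _ _) => //= k ->; rewrite andbT.
by apply/allP => y; rewrite mem_nseq => /andP[_ /eqP ->] /=.
Qed.

Lemma eigenvalues_extremal (R : rcfType) n (M : 'M[R]_n) (x : R) :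
  size (eigenvalues M) = n -> x \in eigenvalues M ->
  (eigenvalues M)`_n.-1 <= x <= (eigenvalues M)`_0.
Proof.
move=> sz qx; have le_nth := sorted_leq_nth ge_trans lexx 0 (eigenvalues_sorted M).
have ltxn : (index x (eigenvalues M) < n)%N.
  by rewrite -index_mem sz in qx.
have n_gt0 := leq_ltn_trans (leq0n _) ltxn.
rewrite -[x in _ <= x <= _](nth_index 0 qx).
by apply/andP; split; apply: le_nth; rewrite ?inE ?sz ?prednK // -ltnS prednK.
Qed.

Lemma eigenvalue_mem (R : rcfType) n (M : 'M[R]_n) x :
  (x \in eigenvalues M) = eigenvalue M x.
Proof.
rewrite -has_pred1 has_count count_mem_eigenvalues eigenvalue_root_char.
by rewrite -XsubC_dvd -?size_poly_eq0 ?size_char_poly // dvdp_XsubCl.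
Qed.

(** * Spread of a sequence against its squared deviations *)

(** For end entries [a] and [b], 2(a-c)^2 + 2(b-c)^2 = (a-b)^2 + (a+b-2c)^2, and the inner terms are
    nonnegative. Equality makes every inner entry [c] and puts [a], [b] symmetrically around [c], so
    each [x - c] is 0 or ±l/2, a root of t^3 = (l/2)^2 t. *)
Lemma sqr_head_last_le (R : realFieldType) (q : seq R) (c : R) :
  let s := \sum_(x <- q) (x - c) ^+ 2 in
  let l := q`_0 - q`_(size q).-1 in
  l ^+ 2 <= 2 * s /\
  (l ^+ 2 = 2 * s -> (1 < size q)%N ->
     q`_(size q).-1 = c - l / 2 /\
     {in q, forall x, (x - c) ^+ 3 = (l / 2) ^+ 2 * (x - c)}).
Proof.
case: q => [|a q]; first by rewrite big_nil /= subrr expr0n mulr0.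
case/lastP: q => [|q b].
  by rewrite big_seq1 /= subrr expr0n /= mulr_ge0 ?sqr_ge0 ?ler0n.
rewrite /= size_rcons /= nth_rcons ltnn eqxx big_cons -cats1 big_cat big_seq1 /=.
set s := \sum_(x <- q) _; 
have s_ge0 : 0 <= s by apply: sumr_ge0 => x _; apply: sqr_ge0.
have sumsq : 2 * ((a - c) ^+ 2 + (s + (b - c) ^+ 2)) - (a - b) ^+ 2
             = 2 * s + (a + b - c - c) ^+ 2 by ring.
have sq_ge0 := sqr_ge0 (a + b - c - c).
split=> [|eq_l _]; first by lra.
have s0 : s = 0 by lra.
have /eqP : (a + b - c - c) ^+ 2 = 0 by lra.
rewrite sqrf_eq0 => /eqP abc; split; first by lra.
move=> x; rewrite inE mem_cat inE => /or3P[/eqP->|qx|/eqP->].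
- have -> : b = c + c - a by lra.
  by field.
- suff -> : x = c by rewrite subrr expr0n mulr0.
  apply/eqP; rewrite -subr_eq0 -sqrf_eq0.
  move/eqP: s0; rewrite psumr_eq0; last by move=> y _; apply: sqr_ge0.
  by move/allP/(_ _ qx).
have -> : b = c + c - a by lra.
by field.
Qed.

(** * Degree counting and recognition of complete bipartite graphs *)

(** Ordered adjacent pairs are counted by first vertex, then by underlying edge; each edge has
    exactly the two orientations, distinct by irreflexivity. *)
Lemma sum_deg (T : finType) (G : sgraph T) :
  (\sum_x deg G x = 2 * #|edges G|)%N.
Proof.
have -> : (\sum_x deg G x = \sum_(p : T * T | G p.1 p.2) 1)%N.
  rewrite -(pair_big_dep xpredT (fun x y => G x y) (fun _ _ => 1%N)) /=.
  by apply: eq_bigr => x _; rewrite /deg -sum1dep_card.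
rewrite (partition_big (fun p => [set p.1; p.2]) (mem (edges G))) /=; last first.
  by move=> p Gp; apply: (imset_f (fun p => [set p.1; p.2])); rewrite inE.
rewrite mulnC -sum_nat_const; apply: eq_bigr => e /imsetP[[x y]].
rewrite inE /= => Gxy ->{e}.
have neq_xy : (x, y) != (y, x).
  by apply/eqP => -[eq_xy _]; rewrite eq_xy adj_irr in Gxy.
transitivity #|[set (x, y); (y, x)]|; last by rewrite cards2 neq_xy.
rewrite sum1dep_card.
apply: eq_card => -[u v]; rewrite !inE /= !xpair_eqE.
apply/andP/orP => [[Guv /eqP eq_uv]|].
  have : u \in [set x; y] by rewrite -eq_uv set21.
  have : v \in [set x; y] by rewrite -eq_uv set22.
  rewrite !inE => /orP[/eqP eqv|/eqP eqv] /orP[/eqP equ|/eqP equ];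
    move: Guv; rewrite equ eqv ?adj_irr ?eqxx // => _; by [left|right].
by case=> /andP[/eqP-> /eqP->]; rewrite ?eqxx // adj_sym Gxy setUC.
Qed.

(** The enumerations of [X] and of its complement glue to an injection [g] between types of equal
    cardinality; its inverse is the isomorphism. *)
Lemma isomorphic_Kbip (T : finType) (G : sgraph T) (X : {set T}) :
  (forall u v, G u v = (u \in X) (+) (v \in X)) ->
  isomorphic G (Kbip #|X| #|~: X|).
Proof.
move=> defG.
pose g (u : 'I_#|X| + 'I_#|~: X|) : T :=
  match u with inl i => enum_val i | inr j => enum_val j end.
have gX u : (g u \in X) = (if u is inl _ then true else false).
  by case: u => i /=; have := enum_valP i; rewrite // inE => /negbTE.
have injg : injective g.
  move=> u v eq_g; have := gX u; rewrite eq_g gX.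
  by case: u v eq_g => i [] j //= /enum_val_inj ->.
have [f gK fK] : bijective g.
  by apply: inj_card_bij => //; rewrite card_sum !card_ord cardsC.
exists f; first by exists g.
by move=> x y; rewrite -{2}[x]fK -{2}[y]fK defG !gX; case: (f x) (f y) => ? [].
Qed.

(** Adjacent vertices have disjoint neighbourhoods, as there is no triangle; having [d] elements
    each out of [2 * d], these are complementary. One edge thus determines the two sides. *)
Lemma regular_triangle_free_Kbip (T : finType) (G : sgraph T) (d : nat) :
  #|T| = (2 * d)%N -> (0 < d)%N -> (forall x, deg G x = d) ->
  (forall x y z, G x y -> G y z -> ~~ G z x) ->
  isomorphic G (Kbip d d).
Proof.
move=> cardT d_gt0 degG noT.
have /card_gt0P[x0 _] : (0 < #|T|)%N by rewrite cardT muln_gt0.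
have /card_gt0P[y0] : (0 < #|[set y | G x0 y]|)%N by rewrite [#|_|]degG.
rewrite inE => Gxy0; pose N x := [set y | G x y].
have cardN x : #|N x| = d := degG x.
have disjN x y : G x y -> N x = ~: N y.
  move=> Gxy; apply/eqP; rewrite eqEcard; apply/andP; split.
    by apply/subsetP => z; rewrite !inE adj_sym => Gzx; apply: noT Gzx Gxy.
  by rewrite -(leq_add2l #|N y|) cardsC !cardN cardT mul2n addnn.
have defG u v : G u v = (u \in N y0) (+) (v \in N y0).
  have -> : G u v = (v \in N u) by rewrite inE.
  (* Either [u] is adjacent to [y0], or it lies in the complement of [N y0], which is [N x0]; the
     corresponding edge then determines [N u]. *)
  have [Nu|N'u] := boolP (u \in N y0).
    by rewrite (disjN u y0) ?inE //; move: Nu; rewrite inE adj_sym.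
  rewrite (disjN u x0) ?(disjN x0 y0) ?setCK //.
  by move: N'u; rewrite -in_setC -(disjN x0 y0) // inE adj_sym.
have := isomorphic_Kbip defG.
by rewrite cardN -(disjN x0 y0) // cardN.
Qed.

Lemma sum_enum_val (V : nmodType) (T : finType) (F : T -> V) :
  \sum_(i < #|T|) F (enum_val i) = \sum_x F x.
Proof. by rewrite [RHS](reindex _ (onW_bij _ (@enum_val_bij T))). Qed.

Lemma deg_sum (R : pzSemiRingType) (T : finType) (G : sgraph T) x :
  (deg G x)%:R = \sum_y (G x y)%:R :> R.
Proof.
rewrite /deg -sum1dep_card natr_sum big_mkcond /=.
by apply: eq_bigr => y _; case: (G x y).
Qed.

(** * Traces, quadratic form and row sums of the signless Laplacian *)

Section SignlessLaplacian.
Context {R : rcfType} {T : finType} (G : sgraph T).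
Local Notation Q := (signless_laplacian R G).
Local Notation a i j := ((G (enum_val i) (enum_val j))%:R : R).
Local Notation d i := ((deg G (enum_val i))%:R : R).
Local Notation m := (#|edges G|%:R : R).

Lemma signless_laplacianE (i j : 'I_#|T|) : Q i j = d i *+ (i == j) + a i j.
Proof. by rewrite !mxE. Qed.

Lemma degE (i : 'I_#|T|) : d i = \sum_(j < #|T|) a i j.
Proof. by rewrite deg_sum -(sum_enum_val (fun y => (G _ y)%:R)). Qed.

Lemma tr_signless_laplacian : Q^T = Q.
Proof.
apply/matrixP => i j; rewrite mxE !signless_laplacianE adj_sym.
by case: eqVneq => [->|]; rewrite // eq_sym => /negbTE ->.
Qed.

Lemma sum_degR : \sum_x (deg G x)%:R = 2 * m.
Proof. by rewrite -natr_sum sum_deg natrM. Qed.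

Lemma mxtrace_signless_laplacian : \tr Q = 2 * m.
Proof.
rewrite -sum_degR -sum_enum_val; apply: eq_bigr => i _.
by rewrite signless_laplacianE eqxx adj_irr addr0.
Qed.

Lemma mxtrace_signless_laplacian2 :
  \tr (Q *m Q) = \sum_x (deg G x)%:R ^+ 2 + 2 * m.
Proof.
rewrite -sum_degR -big_split -sum_enum_val; apply: eq_bigr => i _ /=.
rewrite mxE [X in _ + X]degE (bigD1 i) //= [in RHS](bigD1 i) //=.
rewrite signless_laplacianE eqxx adj_irr addr0 add0r -expr2; congr (_ + _).
apply: eq_bigr => j ji; rewrite !signless_laplacianE eq_sym (negbTE ji) !add0r.
by rewrite adj_sym; case: (G _ _); rewrite ?mulr1 ?mulr0.
Qed.

(** The sum runs over ordered pairs, so each edge occurs twice; hence the factor 2 on the left. *)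
Lemma signless_laplacian_quad (v : 'rV[R]_#|T|) :
  2 * (v *m Q *m v^T) 0 0 =
    \sum_(i < #|T|) \sum_(j < #|T|) a i j * (v 0 i + v 0 j) ^+ 2.
Proof.
have -> : (v *m Q *m v^T) 0 0 = \sum_(i < #|T|) d i * v 0 i ^+ 2
    + \sum_(i < #|T|) \sum_(j < #|T|) a i j * (v 0 i * v 0 j).
  rewrite -mulmxA mxE -big_split; apply: eq_bigr => i _ /=.
  rewrite mxE mulr_sumr (eq_bigr (fun j : 'I_#|T| =>
     (d i *+ (i == j)) * (v 0 i * v 0 j) + a i j * (v 0 i * v 0 j))); last first.
    by move=> j _; rewrite signless_laplacianE !mxE; ring.
  rewrite big_split; congr (_ + _).
  rewrite (bigD1 i) //= big1 ?addr0 ?eqxx ?expr2 // => j.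
  by rewrite eq_sym => /negbTE ->; rewrite mul0r.
have dl : \sum_(i < #|T|) d i * v 0 i ^+ 2
    = \sum_(i < #|T|) \sum_(j < #|T|) a i j * v 0 i ^+ 2.
  by apply: eq_bigr => i _; rewrite degE mulr_suml.
(* The two copies of the degree term are expanded differently, to supply the square at each
   endpoint. *)
have dr : \sum_(i < #|T|) d i * v 0 i ^+ 2
    = \sum_(i < #|T|) \sum_(j < #|T|) a i j * v 0 j ^+ 2.
  rewrite dl exchange_big; apply: eq_bigr => i _; apply: eq_bigr => j _.
  by rewrite adj_sym.
rewrite mulrDr mulrDl mul1r [X in X + _ + _]dl dr mulr_sumr -!big_split.
apply: eq_bigr => i _; rewrite mulr_sumr -!big_split; apply: eq_bigr => j _ /=.
by ring.
Qed.

Lemma eigenvalue_signless_laplacian_ge0 x : eigenvalue Q x -> 0 <= x.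
Proof.
case/eigenvalueP => v vQ v0.
have := signless_laplacian_quad v; rewrite vQ -scalemxAl mxE => eq_quad.
have vv_gt0 : 0 < (v *m v^T) 0 0.
  case/rV0Pn: v0 => i vi; rewrite mxE (bigD1 i) //= mxE ltr_pwDl //.
    by rewrite -expr2 exprn_even_gt0.
  by apply: sumr_ge0 => j _; rewrite mxE -expr2 sqr_ge0.
rewrite -(pmulr_lge0 _ vv_gt0) -(pmulr_rge0 _ (ltr0Sn R 1)) eq_quad.
by do 2!apply: sumr_ge0 => ? _; rewrite mulr_ge0 ?ler0n ?sqr_ge0.
Qed.

Lemma const1_signless_laplacian (i : 'I_#|T|) :
  (const_mx 1 *m Q : 'rV_#|T|) 0 i = 2 * d i.
Proof.
rewrite mxE -[Q]tr_signless_laplacian.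
rewrite (eq_bigr (fun j : 'I_#|T| => d i *+ (i == j) + a i j)); last first.
  by move=> j _; rewrite !mxE mul1r.
rewrite big_split /= -degE (bigD1 i) //= eqxx big1 ?addr0 ?mulr1n; first by ring.
by move=> j; rewrite eq_sym => /negbTE ->.
Qed.

End SignlessLaplacian.

(* With [z = w N^2 - l^2 w] one has [z N = 0], hence
   [|z|^2 = l^2 (l^2 |w|^2 - |w N|^2)]. *)
Lemma cube_norm_le (R : realFieldType) n (N : 'M[R]_n) (w : 'rV[R]_n) l :
  N^T = N -> N *m N *m N = l ^+ 2 *: N ->
  \sum_i (w *m N) 0 i ^+ 2 <= l ^+ 2 * \sum_i w 0 i ^+ 2.
Proof.
move=> symN cubeN.
have sqE (u : 'rV[R]_n) : \sum_i u 0 i ^+ 2 = (u *m u^T) 0 0.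
  by rewrite mxE; apply: eq_bigr => i _; rewrite mxE expr2.
rewrite !sqE; set z := w *m N *m N - l ^+ 2 *: w.
have zN : z *m N = 0.
  have wN3 : w *m N *m N *m N = w *m (N *m N *m N) by rewrite !mulmxA.
  by rewrite mulmxBl wN3 cubeN -scalemxAr -scalemxAl subrr.
have wNN : (w *m N) *m (w *m N)^T = w *m N *m N *m w^T.
  by rewrite trmx_mul symN !mulmxA.
have zzE : (z *m z^T) 0 0
    = l ^+ 2 * (l ^+ 2 * (w *m w^T) 0 0 - ((w *m N) *m (w *m N)^T) 0 0).
  have -> : z *m z^T = - l ^+ 2 *: (z *m w^T).
    rewrite {2}/z linearB /= linearZ /= !trmx_mul symN mulmxBr !mulmxA zN !mul0mx.
    by rewrite sub0r -scalemxAr scaleNr.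
  by rewrite wNN mulmxBl -scalemxAl !mxE; ring.
have zz_ge0 : 0 <= (z *m z^T) 0 0.
  by rewrite -sqE; apply: sumr_ge0 => i _; apply: sqr_ge0.
(* For nonzero [l] one divides by l^2. For [l = 0] the identity gives z = w N^2 = 0, so |w N|^2 = w
   N^2 w^T = 0. *)
have [l0|l0] := eqVneq l 0; last first.
  by move: zz_ge0; rewrite zzE pmulr_rge0 ?subr_ge0 // exprn_even_gt0.
have z0 : z = 0.
  apply/rowP => i; rewrite [RHS]mxE; apply/eqP; rewrite -sqrf_eq0.
  move/eqP: zzE; rewrite l0 expr0n mul0r -sqE psumr_eq0; last first.
    by move=> j _; apply: sqr_ge0.
  by move/allP/(_ i (mem_index_enum _)).
have wNN0 : w *m N *m N = 0.
  by rewrite -z0 /z l0 expr0n scale0r subr0.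
by rewrite wNN wNN0 mul0mx mxE l0 expr0n mul0r.
Qed.

Lemma sum_sqr_sub (R : comNzRingType) (q : seq R) c :
  \sum_(x <- q) (x - c) ^+ 2 =
  \sum_(x <- q) x ^+ 2 - 2 * c * \sum_(x <- q) x + c ^+ 2 * (size q)%:R.
Proof.
elim: q => [|x q IHq]; first by rewrite !big_nil /=; ring.
by rewrite !big_cons IHq -natr1 /=; ring.
Qed.

(** * The bound on the spread and its equality case *)

Section Spread.
Context {R : rcfType} {T : finType} (G : sgraph T).
Local Notation Q := (signless_laplacian R G).
Local Notation n := (#|T|%:R : R).
Local Notation m := (#|edges G|%:R : R).
Local Notation sqbound :=
  (2 * (\sum_(x : T) (deg G x)%:R ^+ 2 + 2 * m) - 8 * m ^+ 2 / n).

Lemma sum_sqr_sub_eigenvalues : (0 < #|T|)%N ->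
  2 * \sum_(x <- eigenvalues Q) (x - 2 * m / n) ^+ 2 = sqbound.
Proof.
rewrite -(ltr0n R) => n_gt0.
have [sz s1 s2 _] := symmx_spectrum (tr_signless_laplacian (R := R) G).
rewrite sum_sqr_sub sz s1 s2 mxtrace_signless_laplacian mxtrace_signless_laplacian2.
by field; rewrite gt_eqF.
Qed.

Lemma sqr_sQ_le : (0 < #|T|)%N -> sQ R G ^+ 2 <= sqbound.
Proof.
move=> n_gt0; have [sz _ _ _] := symmx_spectrum (tr_signless_laplacian (R := R) G).
rewrite -sum_sqr_sub_eigenvalues //.
by have [] := sqr_head_last_le (eigenvalues Q) (2 * m / n); rewrite sz.
Qed.

Lemma sQ_le : sQ R G <= Num.sqrt sqbound.
Proof.
(* Without vertices both entries of the empty sequence are the default 0, so the spread is 0. *)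
have [T0|n_gt0] := posnP #|T|; last first.
  by rewrite (le_trans (ler_norm _)) // -sqrtr_sqr ler_wsqrtr ?sqr_sQ_le.
have [sz _ _ _] := symmx_spectrum (tr_signless_laplacian (R := R) G).
rewrite /sQ; move: sz; rewrite [X in size _ = X]T0 => /size0nil ->.
by rewrite !nth_nil subrr sqrtr_ge0.
Qed.

Lemma extremal_cube : (1 < #|T|)%N -> sQ R G ^+ 2 = sqbound ->
  let c := 2 * m / n in let l := sQ R G / 2 in let N := Q - c%:M in
  l <= c /\ N *m N *m N = l ^+ 2 *: N.
Proof.
move=> n_gt1 eq_sQ c l N; have n_gt0 := ltnW n_gt1.
have [sz _ _ cube] := symmx_spectrum (tr_signless_laplacian (R := R) G).
have [_] := sqr_head_last_le (eigenvalues Q) c.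
rewrite sz sum_sqr_sub_eigenvalues // => /(_ eq_sQ n_gt1) [lastE cubeE].
split; last exact: cube.
(* [c - l] is the last eigenvalue, nonnegative because the quadratic form is a sum of squares. *)
rewrite -subr_ge0 -[c - l]lastE.
apply: (eigenvalue_signless_laplacian_ge0 (G := G)).
by rewrite -eigenvalue_mem mem_nth // sz prednK.
Qed.

Lemma extremal_regular : (1 < #|T|)%N -> sQ R G = Num.sqrt sqbound ->
  let c := 2 * m / n in sQ R G / 2 = c /\ forall x, (deg G x)%:R = c.
Proof.
move=> n_gt1 eq_sQ c; have n_gt0 := ltnW n_gt1.
have nR_gt0 : 0 < n by rewrite ltr0n.
have sqsQ : sQ R G ^+ 2 = sqbound.
  by rewrite eq_sQ sqr_sqrtr // (le_trans (sqr_ge0 _) (sqr_sQ_le _)).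
have [le_lc cubeN] := extremal_cube n_gt1 sqsQ.
have l_ge0 : 0 <= sQ R G / 2 by rewrite eq_sQ divr_ge0 ?sqrtr_ge0.
move: le_lc cubeN l_ge0; rewrite -/c; set l := sQ R G / 2.
set N := Q - c%:M => le_lc cubeN l_ge0.
have symN : N^T = N by rewrite linearB /= tr_signless_laplacian tr_scalar_mx.
have := cube_norm_le (const_mx 1) symN cubeN.
have wN i : (const_mx 1 *m N : 'rV_#|T|) 0 i = 2 * (deg G (enum_val i))%:R - c.
  by rewrite mulmxBr mxE const1_signless_laplacian mul_mx_scalar !mxE mulr1.
rewrite (eq_bigr (fun i => (2 * (deg G (enum_val i))%:R - c) ^+ 2)); last first.
  by move=> i _; rewrite wN.
rewrite (sum_enum_val (fun x => (2 * (deg G x)%:R - c) ^+ 2)).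
rewrite [X in _ * X](eq_bigr (fun=> 1)); last by move=> i _; rewrite mxE expr1n.
rewrite sumr_const card_ord => le_ln.
have le_l2 : l ^+ 2 <= c ^+ 2 by rewrite lerXn2r ?nnegrE ?(le_trans l_ge0).
have sum_deg_c : \sum_x ((deg G x)%:R - c) = 0 :> R.
  rewrite sumrB sum_degR sumr_const -mulr_natr /c.
  by field; rewrite gt_eqF.
(* Write 2d - c = 2(d - c) + c; the cross term vanishes since the deviations d - c sum to 0. *)
have sqE : \sum_x (2 * (deg G x)%:R - c) ^+ 2 =
           4 * \sum_x ((deg G x)%:R - c) ^+ 2 + c ^+ 2 * n :> R.
  transitivity (\sum_x (4 * ((deg G x)%:R - c) ^+ 2
                         + (4 * c * ((deg G x)%:R - c) + c ^+ 2))).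
    by apply: eq_bigr => x _; ring.
  rewrite !big_split sumr_const /= -!mulr_sumr sum_deg_c mulr0 add0r.
  by rewrite mulr_natr.
have sum_ge0 : 0 <= \sum_x ((deg G x)%:R - c) ^+ 2.
  by apply: sumr_ge0 => x _; apply: sqr_ge0.
have le_n : l ^+ 2 * n <= c ^+ 2 * n by rewrite ler_wpM2r // ltW.
(* The chain 4 sum (d-c)^2 + c^2 n <= l^2 n <= c^2 n collapses, which gives both regularity and l^2
   = c^2. *)
rewrite sqE in le_ln; have sum0 : \sum_x ((deg G x)%:R - c) ^+ 2 = 0 by lra.
split.
  apply/eqP; rewrite eq_le le_lc -(ler_pXn2r (n := 2)) ?nnegrE ?(le_trans l_ge0) //.
  by rewrite -(ler_pM2r nR_gt0); lra.
move=> x; apply/eqP; rewrite -subr_eq0 -sqrf_eq0.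
move/eqP: sum0; rewrite psumr_eq0; last by move=> y _; apply: sqr_ge0.
by move/allP/(_ x (mem_index_enum _)).
Qed.

Lemma extremal_Kbip : no_isolated_vertex G -> (0 < #|T|)%N ->
  sQ R G = Num.sqrt sqbound ->
  ~~ odd #|T| /\ isomorphic G (Kbip #|T|./2 #|T|./2).
Proof.
move=> hG n_gt0 eq_sQ; have nR_gt0 : 0 < n by rewrite ltr0n.
have /card_gt0P[x0 _] := n_gt0; have [y0 Gxy0] := hG x0.
have n_gt1 : (1 < #|T|)%N.
  apply/card_gt1P; exists x0, y0; split=> //.
  by apply: contraTneq Gxy0 => ->; rewrite adj_irr.
have [lE degE] := extremal_regular n_gt1 eq_sQ.
have sqsQ : sQ R G ^+ 2 = sqbound.
  by rewrite eq_sQ sqr_sqrtr // (le_trans (sqr_ge0 _) (sqr_sQ_le _)).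
have [_ cubeN] := extremal_cube n_gt1 sqsQ.
move: lE degE cubeN; set c := 2 * m / n => lE degE; rewrite lE.
have degx0 x : deg G x = deg G x0 by apply/eqP; rewrite -(eqr_nat R) !degE.
have d_gt0 : (0 < deg G x0)%N by apply/card_gt0P; exists y0; rewrite inE.
have c_gt0 : 0 < c by rewrite -(degE x0) ltr0n.
have cardT : #|T| = (2 * deg G x0)%N.
  apply/eqP; rewrite -(eqr_nat R) natrM degE; apply/eqP.
  (* For degree [c] the squared bound is 2cn while the squared spread is 4c^2; cancelling the
     nonzero [c] leaves n = 2c. *)
  apply: (mulfI (lt0r_neq0 c_gt0)).
  have mE : m = c * n / 2 by rewrite /c; field; rewrite gt_eqF.
  have sQE : sQ R G = 2 * c by rewrite -lE; field.
  have sum2E : \sum_x (deg G x)%:R ^+ 2 = c ^+ 2 * n.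
    rewrite (eq_bigr (fun=> c ^+ 2)) => [|x _]; last by rewrite degE.
    by rewrite sumr_const mulr_natr.
  move: sqsQ; rewrite sQE sum2E.
  have -> : 2 * (c ^+ 2 * n + 2 * m) - 8 * m ^+ 2 / n = 2 * (c * n).
    by rewrite mE; field; rewrite gt_eqF.
  by move=> ?; lra.
have -> : Q - c%:M = adjmx R G.
  by apply/matrixP => i j; rewrite !mxE degE addrAC -mulrnBl subrr mul0rn add0r.
move=> cubeA; have noT x y z : G x y -> G y z -> ~~ G z x.
  move=> Gxy Gyz; apply/negP => Gzx.
  (* The diagonal entry of A^3 = c^2 A at [x] is 0, so every closed 3-walk term vanishes, in
     particular the one through [y] and [z]. *)
  have /matrixP/(_ (enum_rank x) (enum_rank x)) := cubeA.
  rewrite !mxE enum_rankK adj_irr mulr0 => /eqP; rewrite psumr_eq0; last first.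
    move=> i _; rewrite mulr_ge0 // mxE ?ler0n //.
    by apply: sumr_ge0 => j _; rewrite !mxE mulr_ge0.
  move/allP/(_ (enum_rank z) (mem_index_enum _)).
  rewrite !mxE !enum_rankK Gzx mulr1 psumr_eq0; last first.
    by move=> i _; rewrite !mxE mulr_ge0.
  move/allP/(_ (enum_rank y) (mem_index_enum _)); rewrite !mxE !enum_rankK Gxy Gyz.
  by rewrite mulr1 oner_eq0.
rewrite cardT mul2n odd_double doubleK; split=> //.
exact: regular_triangle_free_Kbip cardT d_gt0 degx0 noT.
Qed.

(** The all-ones vector has eigenvalue 2k = n and the vector of signs of the two sides has
    eigenvalue 0, so the extremal eigenvalues are at least [n] apart. *)
Lemma Kbip_sQ_ge k : (0 < #|T|)%N -> #|T| = (2 * k)%N ->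
  isomorphic G (Kbip k k) ->
  (forall x, deg G x = k) /\ n <= sQ R G.
Proof.
move=> n_gt0 cardT [f bijf fG].
have degG x : deg G x = k.
  transitivity #|[set v | Kbip k k (f x) v]|.
    rewrite -(on_card_preimset (f := f)); last exact: onW_bij.
    by apply: eq_card => y; rewrite !inE fG.
  case: (f x) => i.
    rewrite -[RHS](card_ord k) -(card_imset _ (@inr_inj 'I_k 'I_k)).
    apply: eq_card => -[] j; rewrite !inE /=; last by rewrite imset_f.
    by apply/esym/imsetP => -[].
  rewrite -[RHS](card_ord k) -(card_imset _ (@inl_inj 'I_k 'I_k)).
  apply: eq_card => -[] j; rewrite !inE /=; first by rewrite imset_f.
  by apply/esym/imsetP => -[].
split=> //; have [sz _ _ _] := symmx_spectrum (tr_signless_laplacian (R := R) G).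
have eig_n : eigenvalue Q n.
  apply/eigenvalueP; exists (const_mx 1).
    apply/rowP => i; rewrite const1_signless_laplacian degG !mxE.
    by rewrite mulr1 cardT natrM.
  apply/rV0Pn; exists (Ordinal n_gt0); rewrite mxE; exact: oner_neq0.
pose s x : R := if f x is inl _ then 1 else -1.
have eig_0 : eigenvalue Q 0.
  apply/eigenvalueP; exists (\row_i s (enum_val i)).
    apply/rowP => i; rewrite scale0r -[Q]tr_signless_laplacian 2!mxE.
    (* Neighbours lie on opposite sides, so s_j may be replaced by -s_i in each adjacency term; the
       row sum then cancels the degree term. *)
    rewrite (eq_bigr (fun j : 'I_#|T| =>
       s (enum_val j) * (deg G (enum_val i))%:R *+ (i == j)
       - s (enum_val i) * (G (enum_val i) (enum_val j))%:R)); last first.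
      move=> j _; rewrite !mxE -fG /s.
      case: (f (enum_val i)) (f (enum_val j)) => ? [] ? /=;
        by case: (i == j) => /=; ring.
    rewrite sumrB -mulr_sumr -degE (bigD1 i) //= eqxx big1 ?addr0 ?mulr1n ?subrr //.
    by move=> j; rewrite eq_sym => /negbTE ->.
  apply/rV0Pn; exists (Ordinal n_gt0); rewrite mxE /s.
  by case: (f _); rewrite ?oppr_eq0 oner_neq0.
have := eigenvalues_extremal sz; rewrite /sQ => ext.
have /andP[_ le_n] := ext _ (etrans (eigenvalue_mem _ _) eig_n).
have /andP[ge_0 _] := ext _ (etrans (eigenvalue_mem _ _) eig_0).
by lra.
Qed.

(** The upper bound holds in general, so it suffices that the bound is at most [n]: with n = 2k, all
    degrees k and m = k^2, the expression under the root is n^2. *)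
Lemma Kbip_extremal : ~~ odd #|T| -> isomorphic G (Kbip #|T|./2 #|T|./2) ->
  sQ R G = Num.sqrt sqbound.
Proof.
move=> evenT isoG; have [T0|n_gt0] := posnP #|T|.
  have [sz _ _ _] := symmx_spectrum (tr_signless_laplacian (R := R) G).
  have no_edge : #|edges G| = 0%N.
    apply/eqP; rewrite -(eqn_pmul2l (ltn0Sn 1)) -sum_deg muln0 big1 // => x.
    by have := max_card (pred1 x); rewrite card1 T0.
  have no_vertex : \sum_x (deg G x)%:R ^+ 2 = 0 :> R.
    by apply: big1 => x; have := max_card (pred1 x); rewrite card1 T0.
  rewrite /sQ; move: sz; rewrite [X in size _ = X]T0 => /size0nil ->.
  rewrite !nth_nil subrr no_vertex no_edge.
  by rewrite !(mulr0, addr0, mul0r, expr0n, subr0) sqrtr0.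
move: isoG; set k := #|T|./2 => isoG.
have cardT : #|T| = (2 * k)%N by rewrite mul2n even_halfK.
have [degG le_nQ] := Kbip_sQ_ge n_gt0 cardT isoG.
apply/eqP; rewrite eq_le sQ_le /= (le_trans _ le_nQ) //.
have nE : n = 2 * k%:R by rewrite cardT natrM.
have n_gt0R : 0 < n by rewrite ltr0n.
have k_gt0 : 0 < k%:R :> R by lra.
have mE : m = k%:R * k%:R.
  have := sum_degR (R := R) G.
  rewrite (eq_bigr (fun=> k%:R)) => [|x _]; last by rewrite degG.
  by rewrite sumr_const -[_ *+ #|_|]mulr_natr nE => ?; lra.
have sum2E : \sum_x (deg G x)%:R ^+ 2 = k%:R ^+ 2 * n.
  rewrite (eq_bigr (fun=> k%:R ^+ 2)) => [|x _]; last by rewrite degG.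
  by rewrite sumr_const mulr_natr.
have -> : sqbound = n ^+ 2 by rewrite sum2E mE nE; field; rewrite gt_eqF.
by rewrite sqrtr_sqr gtr0_norm.
Qed.
End Spread.

Theorem theorem31 (R : rcfType) (T : finType) (G : sgraph T)
    (hG : no_isolated_vertex G) :
  let n : R := #|T|%:R in
  let m : R := #|edges G|%:R in
  let bound := Num.sqrt (2 * (\sum_(x : T) (deg G x)%:R ^+ 2 + 2 * m)
                         - 8 * m ^+ 2 / n) in
  [/\ sQ R G <= bound,
      bound = Num.sqrt (2 * (zagreb1 G)%:R + 4 * m - 8 * m ^+ 2 / n)
    & sQ R G = bound <->
      ~~ odd #|T| /\ isomorphic G (Kbip #|T|./2 #|T|./2)].
Proof.
move=> n m bound; split; first exact: sQ_le.
  congr Num.sqrt; rewrite /zagreb1 natr_sum.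
  by rewrite (eq_bigr _ (fun x _ => natrX R (deg G x) 2)); ring.
split=> [eq_sQ|[evenT isoG]]; last exact: Kbip_extremal.
have [T0|n_gt0] := posnP #|T|; last exact: extremal_Kbip eq_sQ.
have T_empty (A : {set T}) : #|A| = 0%N.
  by apply/eqP; rewrite -leqn0 (leq_trans (max_card _)) // T0.
rewrite T0; split=> //.
(* The graph without vertices is K_{0,0}: the empty set and its complement both have cardinality
   0. *)
have := @isomorphic_Kbip T G set0; rewrite !T_empty; apply=> u.
by have := max_card (pred1 u); rewrite card1 T0.
Qed.
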